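(* Let $u$ be a localization and let $$\beth(q,\hat\theta) := \int_{\Theta}\phi(q;\theta)\,g_1(\hat\theta,\theta)\,u(\theta)\,d\theta .$$ Suppose $q_{\mathrm{OVP}}\in\mathcal{Q}^{\mathcal{S}}$ is an MLE-sufficient prescriptive solution that point-wise minimizes $\beth(\cdot,\hat\theta)$ for every $\hat\theta\in\Theta$, i.e. for every $\hat\theta\in\Theta$ the value $q_{\mathrm{OVP}}(\hat\theta)$ minimizes $q\mapsto\beth(q,\hat\theta)$ over $q\in\mathcal{Q}$. Then $q_{\mathrm{OVP}}$ is out-of-sample locally optimal about $u$, i.e. it minimizes $\Psi[\,\cdot\,;u]$ over prescriptive solutions.
   Context: Setting. $\mathcal{Q}\subseteq\mathbb{R}$ is the feasible set of decisions $q$. The uncertain variable $d$ takes values in an outcome space $\mathcal{D}$ (with reference measure written $dd$), and $C(q,d)$ is a real-valued cost function. The hypothesis set is a family of probability densities $\{f(\cdot;\theta):\theta\in\Theta\}$ on $\mathcal{D}$ with $\Theta\subseteq\mathbb{R}^o$. The expected cost is $\phi(q;\theta):=\int_{\mathcal{D}}C(q,d)f(d;\theta)\,dd$. Data. A data set of size $N$ is $\boldsymbol y=(y_1,\dots,y_N)\in\mathcal{Y}:=\mathcal{D}^N$, consisting of i.i.d. samples from $f(\cdot;\theta)$, with joint density $g(\boldsymbol y;\theta):=\prod_{n=1}^N f(y_n;\theta)$. A prescriptive solution is a function $\boldsymbol y\mapsto q(\boldsymbol y)$ from $\mathcal{Y}$ to $\mathbb{R}$, feasible in the sense that $q(\boldsymbol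 y)\in\mathcal{Q}$, with no explicit dependence on $\theta$. Localization and performance. A localization $u$ is a probability density on $\Theta$. The expected out-of-sample performance of $q(\cdot)$ with respect to $u$ is $$\Psi[q(\cdot);u]:=\int_\Theta\int_{\mathcal{Y}}\int_{\mathcal{D}}C(q(\boldsymbol y),d)\,f(d;\theta)\,g(\boldsymbol y;\theta)\,u(\theta)\,dd\,d\boldsymbol y\,d\theta .$$ A prescriptive solution is out-of-sample locally optimal about $u$ (''locally optimal'' for short) if it minimizes $\Psi[\,\cdot\,;u]$. Sufficient statistic. $\hat\theta:\mathcal{Y}\to\Theta$ is the maximum likelihood estimator, $\hat\theta(\boldsymbol y)$ maximizing $g(\boldsymbol y;\theta)$ over $\theta\in\Theta$. It is assumed to be a sufficient statistic, so there are non-negative functions $g_0,g_1$ with $g(\boldsymbol y;\theta)=g_0(\boldsymbol y)\,g_1(\hat\theta(\boldsymbol y),\theta)$ for all $\boldsymbol y\in\mathcal{Y}$, $\theta\in\Theta$. A prescriptive solution is MLE-sufficient if it depends on $\boldsymbol y$ only through $\hat\theta(\boldsymbol y)$, i.e. it can be written $q(\hat\theta(\boldsymbol y))$ for a function $q(\hat\theta)$ of $\hat\theta\in\Theta$; $\mathcal{Q}^{\mathcal{S}}$ is the class of these. Convention. All functions are measurable, and the integrals written are assumed to be well defined with interchange of the order of integration permitted. *)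

(* Defs.v *)
From HB Require Import structures.
From mathcomp Require Import all_boot all_order all_algebra.
From mathcomp Require Import all_classical all_reals all_analysis.
From mathcomp Require Import measurable_realfun.
Set Implicit Arguments.
Unset Strict Implicit.
Unset Printing Implicit Defensive.
Import Order.TTheory GRing.Theory Num.Theory.
Import numFieldNormedType.Exports.
Local Open Scope classical_set_scope.
Local Open Scope ring_scope.
Local Open Scope ereal_scope.

Section tuple_cons.
Context {d} {T : measurableType d} (n : nat).

Definition tcons (p : T * n.-tuple T) : n.+1.-tuple T :=
  [tuple of p.1 :: p.2].

Definition tuncons (t : n.+1.-tuple T) : T * n.-tuple T :=
  (thead t, [tuple of behead t]).

Lemma tconsK : cancel tcons tuncons.
Proof.
move=> [x t]; rewrite /tuncons /tcons theadE; congr pair.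
exact: val_inj.
Qed.

Lemma tunconsK : cancel tuncons tcons.
Proof. by move=> t; rewrite [RHS]tuple_eta; exact: val_inj. Qed.

Lemma measurable_tcons : measurable_fun [set: T * n.-tuple T] tcons.
Proof. exact: measurable_cons. Qed.

Lemma measurable_tuncons : measurable_fun [set: n.+1.-tuple T] tuncons.
Proof.
apply: measurable_fun_pair; first exact: measurable_tnth.
exact: measurable_behead.
Qed.

End tuple_cons.

Section tuple_measure_succ.
Context {R : realType} {d} {T : measurableType d} (n : nat).
Variable mu : {sigma_finite_measure set T -> \bar R}.
Variable m : {sigma_finite_measure set (n.-tuple T) -> \bar R}.

Definition tuple_measure_succ : set (n.+1.-tuple T) -> \bar R :=
  pushforward (mu \x m) (@tcons _ T n).

Let nu : {measure set (n.+1.-tuple T) -> \bar R} :=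
  measure_function_pushforward__canonical__measure_function_Measure
    (mu \x m) (@measurable_tcons _ T n).

HB.instance Definition _ := isMeasure.Build _ _ _ tuple_measure_succ
  (measure0 nu) (measure_ge0 nu) (@measure_semi_sigma_additive _ _ _ nu).

Let tuple_measure_succ_sigma_finite : sigma_finite setT tuple_measure_succ.
Proof.
have /sigma_finiteP[F [FT ndF Foo]] := sigma_finiteT mu.
have /sigma_finiteP[G [GT ndG Goo]] := sigma_finiteT m.
exists (fun k => @tuncons _ T n @^-1` (F k `*` G k)).
  apply/esym; rewrite -subTset => t _ /=.
  have : setT (tuncons t).1 by []. rewrite FT => -[i _ Fi].
  have : setT (tuncons t).2 by []. rewrite GT => -[j _ Gj].
  exists (maxn i j) => //; split.
    by move: Fi; exact/subsetPset/ndF/leq_maxl.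
  by move: Gj; exact/subsetPset/ndG/leq_maxr.
move=> k; have [mF Fk] := Foo k; have [mG Gk] := Goo k; split.
  rewrite -[X in measurable X]setTI; apply: measurable_tuncons => //.
  exact: measurableX.
rewrite /tuple_measure_succ /pushforward -comp_preimage.
rewrite (_ : _ \o _ = id); last by apply/funext => p /=; rewrite tconsK.
by rewrite preimage_id product_measure1E// lte_mul_pinfty// ge0_fin_numE.
Qed.

HB.instance Definition _ := Measure_isSigmaFinite.Build _ _ _
  tuple_measure_succ tuple_measure_succ_sigma_finite.

End tuple_measure_succ.

Section tuple_measure.
Context {R : realType} {d} {T : measurableType d}.
Variable mu : {sigma_finite_measure set T -> \bar R}.

(* The n-fold product measure on n-tuples; tuple_measure_box is its
   characterization on boxes. *)
Fixpoint tuple_measure (n : nat) :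
    {sigma_finite_measure set (n.-tuple T) -> \bar R} :=
  if n is n'.+1 then tuple_measure_succ mu (tuple_measure n')
  else \d_ ([tuple] : 0.-tuple T).

Lemma tuple_measure_box (n : nat) (A : 'I_n -> set T) :
  (forall i, measurable (A i)) ->
  tuple_measure n [set t | forall i, A i (tnth t i)] =
  \prod_(i < n) mu (A i).
Proof.
elim: n A => [|n IH] A mA.
  by rewrite big_ord0 /= diracE mem_set// => -[].
rewrite big_ord_recl -IH// /= /tuple_measure_succ /pushforward.
rewrite -product_measure1E//.
  congr (_ _); apply/seteqP; split => [[x t]/= h|[x t]/= [h0 h] i].
    split; first by have := h ord0; rewrite tnth0.
    by move=> i; have := h (lift ord0 i); rewrite tnthS.
  by have [j ->|->] := unliftP ord0 i; rewrite ?tnthS ?tnth0.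
rewrite (_ : [set t | _] =
    \bigcap_(i in [set: 'I_n]) ((@tnth n T)^~ i @^-1` A (lift ord0 i))).
  apply: fin_bigcap_measurable => // i _.
  by rewrite -[X in measurable X]setTI; exact: measurable_tnth.
by apply/seteqP; split => [t h i _|t h i]; exact: h.
Qed.

End tuple_measure.

(* R^o with its Borel sigma-algebra; measurableTypeR R is the type R itself *)
Notation real_vec R o := (o.-tuple (measurableTypeR R)).

Definition lebesgue_vec (R : realType) (o : nat) :
    {sigma_finite_measure set (real_vec R o) -> \bar R} :=
  tuple_measure (@lebesgue_measure R) o.

Section integrals.
Context {R : realType} {d} {T : measurableType d}.
Implicit Types (m : set T -> \bar R) (A : set T).

Definition density m A (h : T -> R) :=
  [/\ measurable_fun A h, (forall x, A x -> (0 <= h x)%R)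
    & \int[m]_(x in A) (h x)%:E = 1].

(* The integral of h over A has a meaning in [-oo, +oo]: it is not of the form
   oo - oo, in which case the library's integral has a default value. For a
   product measure this is the hypothesis of both Tonelli's and Fubini's
   theorems. *)
Definition quasi_integrable m A (h : T -> \bar R) :=
  measurable_fun A h /\
  (\int[m]_(x in A) h^\+ x < +oo \/ \int[m]_(x in A) h^\- x < +oo).

End integrals.

Definition minimizes (R : realType) (T : Type) (A : set T) (F : T -> \bar R)
  (x : T) := A x /\ forall x', A x' -> F x <= F x'.

Section prescriptive_analytics.
Context {R : realType} {d} {D : measurableType d}.
Variable mu : {sigma_finite_measure set D -> \bar R}.
Context {o N : nat}.
Implicit Types (Q : set R) (C : R -> D -> R) (Theta : set (real_vec R o)).
Implicit Types (f : real_vec R o -> D -> R) (u : real_vec R o -> R).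
Implicit Types (that : N.-tuple D -> real_vec R o) (q : N.-tuple D -> R).

Definition hypothesis_set Theta f :=
  measurable_fun (Theta `*` [set: D]) (fun p => f p.1 p.2) /\
  forall t, Theta t -> density mu setT (f t).

Definition expected_cost C f (x : R) (t : real_vec R o) : \bar R :=
  \int[mu]_z (C x z * f t z)%:E.

Definition likelihood f (y : N.-tuple D) (t : real_vec R o) : R :=
  (\prod_(n < N) f t (tnth y n))%R.

Definition is_mle Theta f that :=
  [/\ measurable_fun setT that, (forall y, Theta (that y))
    & forall y t, Theta t -> (likelihood f y t <= likelihood f y (that y))%R].

Definition sufficient_factorization Theta f that (g0 : N.-tuple D -> R)
    (g1 : real_vec R o -> real_vec R o -> R) :=
  [/\ measurable_fun setT g0 /\ (forall y, (0 <= g0 y)%R),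
      measurable_fun (Theta `*` Theta) (fun p => g1 p.1 p.2) /\
        (forall s t, Theta s -> Theta t -> (0 <= g1 s t)%R)
    & forall y t, Theta t -> likelihood f y t = (g0 y * g1 (that y) t)%R].

Definition localization Theta u := density (lebesgue_vec R o) Theta u.

Definition prescriptive Q q := measurable_fun setT q /\ forall y, Q (q y).

Definition mle_sufficient Q Theta that q :=
  prescriptive Q q /\
  exists2 qhat : real_vec R o -> R,
    measurable_fun Theta qhat & forall y, q y = qhat (that y).

Definition Psi C Theta f u q : \bar R :=
  \int[lebesgue_vec R o]_(t in Theta) \int[tuple_measure mu N]_y \int[mu]_z
    (C (q y) z * f t z * likelihood f y t * u t)%:E.

(* The integrand of Psi, jointly in ((theta, y), z): when it is quasi-integrable
   for the product measure, Psi is well defined and the order of integration is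
   irrelevant. *)
Definition Psi_defined C Theta f u q :=
  quasi_integrable ((lebesgue_vec R o \x tuple_measure mu N) \x mu)
    ((Theta `*` setT) `*` setT)
    (fun p => (C (q p.1.2) p.2 * f p.1.1 p.2 * likelihood f p.1.2 p.1.1
               * u p.1.1)%:E).

Definition locally_optimal Q C Theta f u q :=
  minimizes [set q' | prescriptive Q q' /\ Psi_defined C Theta f u q']
    (Psi C Theta f u) q.

Definition beth C Theta f (g1 : real_vec R o -> real_vec R o -> R) u (x : R)
    (s : real_vec R o) : \bar R :=
  \int[lebesgue_vec R o]_(t in Theta)
    (expected_cost C f x t * (g1 s t)%:E * (u t)%:E).

End prescriptive_analytics.

(* Main.v *)
(* With h the integrand of Psi, Fubini's theorem gives
   Psi[q] = \int_y \int_theta \int_z h, and since the likelihood factors as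
   g0 y * g1 (thetahat y) theta, the two inner integrals equal
   g0 y * beth (q y) (thetahat y).  As g0 is nonnegative, q_OVP minimizes this
   quantity for every single y, hence also its integral.  Neither beth nor the
   inner integrals need be finite, so Fubini is used for quasi-integrable
   functions with values in [-oo, +oo]. *)
Require Import Defs.
From HB Require Import structures.
From mathcomp Require Import all_boot all_order all_algebra.
From mathcomp Require Import all_classical all_reals all_analysis.
From mathcomp Require Import measurable_realfun.
Set Implicit Arguments.
Unset Strict Implicit.
Unset Printing Implicit Defensive.
Import Order.TTheory GRing.Theory Num.Theory.
Import numFieldNormedType.Exports.
Local Open Scope classical_set_scope.
Local Open Scope ring_scope.
Local Open Scope ereal_scope.

(** * Extended-real integrals outside the integrable case *)

(** The decomposition of [x - y] into positive and negative parts, written additively so that it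
    survives [x = y = +oo]: there [x - y] is -oo, the parts are 0 and +oo, and both sides equal
    +oo. *)
Lemma maxeB_ge0 (R : realDomainType) (x y : \bar R) : 0 <= x -> 0 <= y ->
  [/\ maxe (x - y) 0 <= x, maxe (- (x - y)) 0 <= y
    & maxe (x - y) 0 + y = x + maxe (- (x - y)) 0].
Proof.
move: x y => [p| |] [q| |] //= p0 q0.
- rewrite -EFinB -!EFin_max -!EFinD !lee_fin.
  move: p0 q0; rewrite !lee_fin => p0 q0.
  rewrite !ge_max opprB !gerBl p0 q0.
  split=> //; case: (leP p q) => pq.
    by rewrite max_r ?subr_le0// max_l ?subr_ge0// add0r addrC subrK.
  have qp := ltW pq.
  by rewrite max_l ?subr_ge0// max_r ?subr_le0// subrK addr0.
- by rewrite addeNy maxNye maxye addey.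
- by rewrite addye// maxye maxNye adde0 leey addye.
- by rewrite addeNy maxNye maxye add0e.
Qed.

Section integral_extended.
Context {R : realType} {d} {T : measurableType d}.
Variable m : {measure set T -> \bar R}.

(** Passing from [f] to [g] raises the positive part and lowers the negative one. Since +oo - oo is
    read as -oo, addition stays monotone, so the difference of the two integrals is ordered even
    when it is degenerate. *)
Lemma le_integral_measurable (A : set T) (f g : T -> \bar R) :
  measurable A -> measurable_fun A f -> measurable_fun A g ->
  (forall x, A x -> f x <= g x) ->
  \int[m]_(x in A) f x <= \int[m]_(x in A) g x.
Proof.
move=> mA mf mg fg.
have {}fg : {in A, forall x, f x <= g x} by move=> x /set_mem; exact: fg.
rewrite integralE [leRHS]integralE leeB//; apply: ge0_le_integral => //.
- exact: measurable_funepos.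
- exact: measurable_funepos.
- by move=> x /mem_set; exact: (funepos_le fg).
- exact: measurable_funeneg.
- exact: measurable_funeneg.
- by move=> x /mem_set; exact: (funeneg_le fg).
Qed.

(* f need not be quasi-integrable: for k > 0, both sides are then the junk value
   +oo - oo = -oo. *)
Lemma integralZl_ge0_EFin (A : set T) (f : T -> \bar R) (k : R) :
  measurable A -> measurable_fun A f -> (0 <= k)%R ->
  \int[m]_(x in A) (k%:E * f x) = k%:E * \int[m]_(x in A) f x.
Proof.
move=> mA mf; rewrite le_eqVlt => /predU1P[<-|k0].
  by rewrite mul0e; under eq_integral do rewrite mul0e; rewrite integral0.
have k0' := ltW k0.
rewrite integralE [in RHS]integralE ge0_funeposM// ge0_funenegM//.
rewrite !ge0_integralZl_EFin//; last 2 first.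
- exact: measurable_funeneg.
- exact: measurable_funepos.
have [p0 n0] : 0 <= \int[m]_(x in A) f^\+ x /\ 0 <= \int[m]_(x in A) f^\- x.
  by split; apply: integral_ge0.
rewrite -muleN.
move: (\int[m]_(x in A) f^\+ x) (\int[m]_(x in A) f^\- x) p0 n0.
move=> [a| |] [b| |] //= _ _; first by rewrite -EFinD -!EFinM mulrDr.
all: by rewrite ?(gt0_muley, gt0_muleNy) ?lte_fin.
Qed.

(* f^\+ + b = a + f^\- holds pointwise, even where a = b = +oo; it can therefore
   be integrated without removing a null set. *)
Lemma integralB_ge0 (a b : T -> \bar R) (f := fun x => a x - b x) :
  measurable_fun setT a -> measurable_fun setT b ->
  (forall x, 0 <= a x) -> (forall x, 0 <= b x) ->
  \int[m]_x a x < +oo \/ \int[m]_x b x < +oo ->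
  quasi_integrable m setT f /\
  \int[m]_x f x = \int[m]_x a x - \int[m]_x b x.
Proof.
move=> ma mb a0 b0 ab.
have mf : measurable_fun setT f by exact: emeasurable_funB.
have fE x := maxeB_ge0 (a0 x) (b0 x).
have fa x : f^\+ x <= a x by have [+ _ _] := fE x; rewrite funeposE.
have fb x : f^\- x <= b x by have [_ + _] := fE x; rewrite funenegE.
have E x : f^\+ x + b x = a x + f^\- x.
  by have [_ _] := fE x; rewrite funeposE funenegE.
have mp : measurable_fun setT f^\+ by exact: measurable_funepos.
have mn : measurable_fun setT f^\- by exact: measurable_funeneg.
have ifa : \int[m]_x f^\+ x <= \int[m]_x a x by exact: ge0_le_integral.
have ifb : \int[m]_x f^\- x <= \int[m]_x b x by exact: ge0_le_integral.
split.
  by split=> //; case: ab => ab; [left|right]; exact: le_lt_trans ab.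
have iE : \int[m]_x f^\+ x + \int[m]_x b x = \int[m]_x a x + \int[m]_x f^\- x.
  by rewrite -!ge0_integralD//; exact: eq_integral.
rewrite integralE.
have p0 : 0 <= \int[m]_x f^\+ x by exact: integral_ge0.
have n0 : 0 <= \int[m]_x f^\- x by exact: integral_ge0.
have ia0 : 0 <= \int[m]_x a x by exact: integral_ge0.
have ib0 : 0 <= \int[m]_x b x by exact: integral_ge0.
(* By [ab], one of the integrals of [a] and [b] is finite, hence so is that of [f^\+] or [f^\-],
   which it bounds; [iE] then rearranges into the claim without meeting +oo - oo. *)
move: ab ifa ifb iE p0 n0 ia0 ib0.
move: (\int[m]_x f^\+ x) (\int[m]_x f^\- x) (\int[m]_x a x) (\int[m]_x b x).
move=> [p| |] [n| |] [a'| |] [b'| |] //= ab _ _; try by case: ab.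
all: try by move=> *.
move=> -[pb] _ _ _ _; rewrite -!EFinB; congr EFin.
by apply/eqP; rewrite subr_eq addrAC eq_sym subr_eq pb.
Qed.

End integral_extended.

(** * Fubini's theorem for quasi-integrable functions *)

Section fubini_quasi_integrable.
Context {R : realType} {d1 d2} {T1 : measurableType d1} {T2 : measurableType d2}.
Variable m1 : {sigma_finite_measure set T1 -> \bar R}.
Variable m2 : {sigma_finite_measure set T2 -> \bar R}.
Implicit Types (A : set T1) (h : T1 * T2 -> \bar R).

Lemma measurable_fun_integral_sectionT h : measurable_fun setT h ->
  measurable_fun setT (fun x => \int[m2]_y h (x, y)).
Proof.
move=> mh; rewrite (_ : (fun x => _) = fubini_F m2 h^\+ \- fubini_F m2 h^\-).
  by apply: emeasurable_funB; apply: measurable_fun_fubini_tonelli_F => //;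
    [exact: measurable_funepos|exact: measurable_funeneg].
by apply/funext => x; rewrite integralE (funepos_comp h (pair x))
  (funeneg_comp h (pair x)).
Qed.

(** Extension by zero off a cylinder commutes with taking sections; this reduces Fubini over [A] to
    Fubini over the whole space. *)
Lemma restrict_setXT A h x y : (h \_ (A `*` setT)) (x, y) =
  ((fun x' => h (x', y)) \_ A) x.
Proof. by rewrite !patchE in_setX in_setT andbT. Qed.

Lemma integral_restrict_setXT A h :
  (fun x => \int[m2]_y (h \_ (A `*` setT)) (x, y)) =
  (fun x => \int[m2]_y h (x, y)) \_ A.
Proof.
apply/funext => x; rewrite patchE.
under eq_integral do rewrite restrict_setXT patchE.
by case: ifPn => // _; rewrite integral0.
Qed.

Lemma measurable_fun_integral_section A h : measurable A ->
  measurable_fun (A `*` setT) h ->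
  measurable_fun A (fun x => \int[m2]_y h (x, y)).
Proof.
move=> mA /measurable_restrictT mh; apply/measurable_restrictT => //.
rewrite -integral_restrict_setXT; apply: measurable_fun_integral_sectionT.
by apply: mh; exact: measurableX.
Qed.

(** Tonelli applied to [h^\+] and [h^\-] gives two nonnegative functions of [x], one of finite
    integral, whose difference is the inner integral. At exceptional [x] both may be infinite, a
    case that [integralB_ge0] covers. *)
Lemma quasi_integrable_fubini1 h : quasi_integrable (m1 \x m2) setT h ->
  quasi_integrable m1 setT (fun x => \int[m2]_y h (x, y)) /\
  \int[m1 \x m2]_p h p = \int[m1]_x \int[m2]_y h (x, y).
Proof.
move=> [mh hoo].
have mp : measurable_fun setT h^\+ by exact: measurable_funepos.
have mn : measurable_fun setT h^\- by exact: measurable_funeneg.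
have := @integralB_ge0 _ _ _ m1 (fubini_F m2 h^\+) (fubini_F m2 h^\-).
rewrite -(fubini_tonelli1 _ mp)// -(fubini_tonelli1 _ mn)//.
rewrite -(integralE (m1 \x m2) setT h).
rewrite (_ : (fun x => _ - _) = (fun x => \int[m2]_y h (x, y))); last first.
  by apply/funext => x; rewrite [RHS]integralE (funepos_comp h (pair x))
    (funeneg_comp h (pair x)).
move=> /(_ _ _ _ _ hoo) []//.
- exact: measurable_fun_fubini_tonelli_F.
- exact: measurable_fun_fubini_tonelli_F.
- by move=> x; exact: integral_ge0.
- by move=> x; exact: integral_ge0.
Qed.

Lemma quasi_integrable_fubini2 h : quasi_integrable (m1 \x m2) setT h ->
  quasi_integrable m2 setT (fun y => \int[m1]_x h (x, y)) /\
  \int[m1 \x m2]_p h p = \int[m2]_y \int[m1]_x h (x, y).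
Proof.
move=> [mh hoo].
have mp : measurable_fun setT h^\+ by exact: measurable_funepos.
have mn : measurable_fun setT h^\- by exact: measurable_funeneg.
have := @integralB_ge0 _ _ _ m2 (fubini_G m1 h^\+) (fubini_G m1 h^\-).
rewrite -(fubini_tonelli2 _ mp)// -(fubini_tonelli2 _ mn)//.
rewrite -(integralE (m1 \x m2) setT h).
rewrite (_ : (fun x => _ - _) = (fun y => \int[m1]_x h (x, y))); last first.
  by apply/funext => y; rewrite [RHS]integralE (funepos_comp h (pair^~ y))
    (funeneg_comp h (pair^~ y)).
move=> /(_ _ _ _ _ hoo) []//.
- exact: measurable_fun_fubini_tonelli_G.
- exact: measurable_fun_fubini_tonelli_G.
- by move=> y; exact: integral_ge0.
- by move=> y; exact: integral_ge0.
Qed.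

Lemma quasi_integrable_restrictT d (T : measurableType d)
    (m : {measure set T -> \bar R}) (B : set T) (g : T -> \bar R) :
  measurable B ->
  quasi_integrable m B g <-> quasi_integrable m setT (g \_ B).
Proof.
move=> mB; rewrite /quasi_integrable funepos_restrict funeneg_restrict.
have mE := measurable_restrictT g mB.
by rewrite -!integral_mkcond; split=> -[/mE mg].
Qed.

(** Integrating out one variable preserves the hypothesis of Fubini's theorem, so the theorem can be
    iterated. *)
Lemma quasi_integrable_integral_section A h : measurable A ->
  quasi_integrable (m1 \x m2) (A `*` setT) h ->
  quasi_integrable m1 A (fun x => \int[m2]_y h (x, y)).
Proof.
move=> mA /quasi_integrable_restrictT qh; apply/quasi_integrable_restrictT => //.
have /qh /quasi_integrable_fubini1[] : measurable (A `*` [set: T2]).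
  exact: measurableX.
by rewrite integral_restrict_setXT.
Qed.

Lemma quasi_integrable_swap A h : measurable A ->
  quasi_integrable (m1 \x m2) (A `*` setT) h ->
  measurable_fun setT (fun y => \int[m1]_(x in A) h (x, y)) /\
  \int[m1]_(x in A) \int[m2]_y h (x, y) =
  \int[m2]_y \int[m1]_(x in A) h (x, y).
Proof.
move=> mA /quasi_integrable_restrictT qh.
have {}qh := qh (measurableX mA measurableT).
have [_ E1] := quasi_integrable_fubini1 qh.
have [[mG _] E2] := quasi_integrable_fubini2 qh.
have GE : (fun y => \int[m1]_x (h \_ (A `*` setT)) (x, y)) =
          (fun y => \int[m1]_(x in A) h (x, y)).
  apply/funext => y; rewrite [RHS]integral_mkcond.
  by apply: eq_integral => x _; rewrite restrict_setXT.
by rewrite -GE; split; last rewrite -E2 E1 integral_mkcond integral_restrict_setXT.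
Qed.

End fubini_quasi_integrable.

(** * Interchange on a product of three spaces *)

Section product_sigma_finite.
Context {R : realType} {d1 d2} {T1 : measurableType d1} {T2 : measurableType d2}.
Variable m1 : {sigma_finite_measure set T1 -> \bar R}.
Variable m2 : {sigma_finite_measure set T2 -> \bar R}.

Lemma product_measure1_sigma_finite : sigma_finite setT (m1 \x m2).
Proof.
have /sigma_finiteP[F [FT ndF Foo]] := sigma_finiteT m1.
have /sigma_finiteP[G [GT ndG Goo]] := sigma_finiteT m2.
exists (fun k => F k `*` G k).
  apply/esym; rewrite -subTset => -[x y] _ /=.
  have : setT x by []. rewrite FT => -[i _ Fi].
  have : setT y by []. rewrite GT => -[j _ Gj].
  (* [F] and [G] are nondecreasing, so the larger index serves both coordinates. *)
  exists (maxn i j) => //; split.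
    by move: Fi; exact/subsetPset/ndF/leq_maxl.
  by move: Gj; exact/subsetPset/ndG/leq_maxr.
move=> k; have [mF Fk] := Foo k; have [mG Gk] := Goo k.
split; first exact: measurableX.
by rewrite product_measure1E// lte_mul_pinfty// ge0_fin_numE.
Qed.

(* The library's sigma-finite structure on m1 \x m2 is not found by unification. *)
Definition product_sigma_finite_measure :
    {sigma_finite_measure set (T1 * T2)%type -> \bar R} :=
  HB.pack (m1 \x m2)
    (Measure_isSigmaFinite.Build _ _ _ (m1 \x m2) product_measure1_sigma_finite).

End product_sigma_finite.

(** The variable [z] is innermost on both sides: once it is integrated out, a quasi-integrable
    function of [(x, y)] is left, and the two-variable interchange applies. *)
Lemma quasi_integrable_swap3 {R : realType} {d1 d2 d3}
    {T1 : measurableType d1} {T2 : measurableType d2} {T3 : measurableType d3}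
    (m1 : {sigma_finite_measure set T1 -> \bar R})
    (m2 : {sigma_finite_measure set T2 -> \bar R})
    (m3 : {sigma_finite_measure set T3 -> \bar R})
    (A : set T1) (h : (T1 * T2) * T3 -> \bar R) : measurable A ->
  quasi_integrable ((m1 \x m2) \x m3) ((A `*` setT) `*` setT) h ->
  measurable_fun setT
    (fun y => \int[m1]_(x in A) \int[m3]_z h ((x, y), z)) /\
  \int[m1]_(x in A) \int[m2]_y \int[m3]_z h ((x, y), z) =
  \int[m2]_y \int[m1]_(x in A) \int[m3]_z h ((x, y), z).
Proof.
move=> mA hq.
pose m12 := product_sigma_finite_measure m1 m2.
have mAT : measurable (A `*` [set: T2]) by exact: measurableX.
have := @quasi_integrable_integral_section _ _ _ _ _ m12 m3 _ h mAT hq.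
exact: quasi_integrable_swap.
Qed.

Lemma measurable_fun_pair_section {d1 d2 d3} {T1 : measurableType d1}
    {T2 : measurableType d2} {T3 : measurableType d3} (A : set T1) (B : set T2)
    (g : T1 -> T2 -> T3) (x : T1) :
  measurable A -> measurable B -> A x ->
  measurable_fun (A `*` B) (fun p => g p.1 p.2) -> measurable_fun B (g x).
Proof.
move=> mA mB Ax mg.
apply: (measurable_comp _ _ mg (_ : measurable_fun B (pair x))).
- exact: measurableX.
- by move=> _ [y By <-].
- exact: measurable_funTS (pair1_measurable x).
Qed.

(** * Reduction of [Psi] to [beth] *)

Section prescriptive_performance.
Context {R : realType} {d} {D : measurableType d}.
Variable mu : {sigma_finite_measure set D -> \bar R}.
Context {o N : nat}.
Variables (C : R -> D -> R) (Theta : set (real_vec R o)).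
Variables (f : real_vec R o -> D -> R) (thetahat : N.-tuple D -> real_vec R o).
Variables (g0 : N.-tuple D -> R) (g1 : real_vec R o -> real_vec R o -> R).
Variable u : real_vec R o -> R.

Lemma measurable_expected_cost (x : R) : measurable Theta ->
  measurable_fun [set: R * D] (fun p => C p.1 p.2) ->
  hypothesis_set mu Theta f -> measurable_fun Theta (expected_cost mu C f x).
Proof.
move=> mTheta mC [mf _].
apply: (@measurable_fun_integral_section _ _ _ _ _ mu Theta
  (fun p => (C x p.2 * f p.1 p.2)%:E)) => //.
apply/measurable_EFinP/measurable_funM => //.
apply: measurable_funTS.
exact: (measurableT_comp mC
  (measurable_fun_pair (measurable_cst x) measurable_snd)).
Qed.

Hypotheses (mTheta : measurable Theta)
  (mC : measurable_fun [set: R * D] (fun p => C p.1 p.2))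
  (hf : hypothesis_set mu Theta f)
  (hmle : is_mle Theta f thetahat)
  (hsuff : sufficient_factorization Theta f thetahat g0 g1)
  (hu : localization Theta u).

Lemma integral_Psi_beth (q : N.-tuple D -> R) (y : N.-tuple D) :
  \int[lebesgue_vec R o]_(t in Theta) \int[mu]_z
    (C (q y) z * f t z * likelihood f y t * u t)%:E =
  (g0 y)%:E * beth mu C Theta f g1 u (q y) (thetahat y).
Proof.
have [_ Tq _] := hmle; have [[_ g00] [mg1 g10] gE] := hsuff.
have [mu' u0 _] := hu.
rewrite /beth -integralZl_ge0_EFin//; last first.
  apply: emeasurable_funM.
    apply: emeasurable_funM; first exact: measurable_expected_cost.
    apply/measurable_EFinP.
    exact: (measurable_fun_pair_section mTheta mTheta (Tq y)).
  exact/measurable_EFinP.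
apply: eq_integral => t /set_mem Tt.
rewrite (gE _ _ Tt).
(* This is the factor free of [z]. Its sign matters: the integral over [z] may be +oo - oo, read as
   -oo, and a negative factor would not commute with that value. *)
have c0 : (0 <= g0 y * g1 (thetahat y) t * u t)%R.
  by rewrite !mulr_ge0 ?g00 ?g10 ?u0.
under eq_integral => z _.
  rewrite -mulrA mulrC EFinM; over.
rewrite integralZl_ge0_EFin//; last first.
  apply/measurable_EFinP/measurable_funM.
    exact: measurableT_comp mC (pair1_measurable (q y)).
  by have [] := hf.2 t Tt.
rewrite -/(expected_cost mu C f (q y) t).
move: (expected_cost _ _ _ _ _) => e.
by rewrite !EFinM -!muleA [e * _]muleC -muleA.
Qed.

(** Fubini moves the integral over [y] outermost, and also supplies the measurability in [y] that
    comparing two such integrals requires. *)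
Lemma Psi_beth (q : N.-tuple D -> R) : Psi_defined mu C Theta f u q ->
  measurable_fun setT
    (fun y => (g0 y)%:E * beth mu C Theta f g1 u (q y) (thetahat y)) /\
  Psi mu C Theta f u q =
  \int[tuple_measure mu N]_y
    ((g0 y)%:E * beth mu C Theta f g1 u (q y) (thetahat y)).
Proof.
move=> hq; have [mG PsiE] := quasi_integrable_swap3 mTheta hq.
have E := funext (integral_Psi_beth q).
by rewrite -E; split.
Qed.

End prescriptive_performance.

Theorem theorem3 (R : realType) (d : measure_display) (D : measurableType d)
  (mu : {sigma_finite_measure set D -> \bar R}) (o N : nat)
  (Q : set R) (C : R -> D -> R)
  (Theta : set (real_vec R o)) (f : real_vec R o -> D -> R)
  (thetahat : N.-tuple D -> real_vec R o)
  (g0 : N.-tuple D -> R) (g1 : real_vec R o -> real_vec R o -> R)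
  (u : real_vec R o -> R) (qOVP : real_vec R o -> R)
  (mTheta : measurable Theta)
  (mC : measurable_fun [set: R * D] (fun p => C p.1 p.2))
  (hf : hypothesis_set mu Theta f)
  (hmle : is_mle Theta f thetahat)
  (hsuff : sufficient_factorization Theta f thetahat g0 g1)
  (hu : localization Theta u)
  (hqS : mle_sufficient Q Theta thetahat (qOVP \o thetahat))
  (hqdef : Psi_defined mu C Theta f u (qOVP \o thetahat))
  (hqmin : forall that, Theta that ->
     minimizes Q (fun x => beth mu C Theta f g1 u x that) (qOVP that)) :
  locally_optimal mu Q C Theta f u (qOVP \o thetahat).
Proof.
have [_ Tq _] := hmle; have [[_ g00] _ _] := hsuff.
split; first by split=> //; exact: hqS.1.
move=> q [[_ Qq] hq].
have [mO ->] := Psi_beth mTheta mC hf hmle hsuff hu hqdef.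
have [mq ->] := Psi_beth mTheta mC hf hmle hsuff hu hq.
apply: (@le_integral_measurable _ _ _ (tuple_measure mu N) _ _ _ measurableT
  mO mq) => y _.
apply: lee_wpmul2l; first by rewrite lee_fin.
(* The competitor [q] may depend on all of [y], but once [y] is fixed [q y] is just a point of [Q],
   to which minimality at [thetahat y] applies. *)
by have [_] := hqmin _ (Tq y); exact.
Qed.
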